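(* Let $G$ be a finite group and let $A$ be an augmented left $G$-module algebra over $k$. Assume that $A$ is left AS-Gorenstein with $\operatorname{injdim}({}_AA)=d$. Then the following hold. (i) The left homological integral $\int_A^l=\operatorname{Ext}^d_A({}_Ak,{}_AA)$ is a one-dimensional left $G$-module, and the $G$-action is compatible with the right $A$-module structure of $\int^l_A$, that is, $g(ta)=(gt)(ga)$ for all $g\in G$, $a\in A$ and $t\in\int^l_A$. (ii) The skew group algebra $A\# kG$ is left AS-Gorenstein with $\operatorname{injdim}({}_{A\# kG}(A\# kG))=d$, and as right $A\# kG$-modules $$\int^l_{A\# kG}\cong\Big(\int^l_A\# kG\Big)^G,$$ where $G$ acts on $\int^l_A\# kG$ diagonally.
   Context: $k$ is an algebraically closed field of characteristic zero (taken to be $\mathbb{C}$ if necessary). AS-Gorenstein: a left Noetherian algebra $A$ with a fixed augmentation map $\varepsilon:A\to k$ is left AS-Gorenstein if (1) $\operatorname{injdim}({}_AA)=d<\infty$ and (2) $\dim\operatorname{Ext}^d_A({}_Ak,{}_AA)=1$ and $\operatorname{Ext}^i_A({}_Ak,{}_AA)=0$ for all $i\ne d$, where ${}_Ak$ is the module given by $\varepsilon$. Its left homological integral is the one-dimensional right $A$-module $\int^l_A:=\operatorname{Ext}^d_A({}_Ak,{}_AA)$. Augmented $G$-module algebra: a left $G$-module algebra $A$ with an augmentation $\varepsilon:A\to k$ that is a $G$-map ($k$ having trivial $G$-action). The skew group algebra $A\# kG$ is $A\otimes kG$ with product $(a\# g)(b\# h)=a(gb)\# gh$; it is augmented by $a\#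 g\mapsto\varepsilon(a)$. $G$-action on Ext: for left $A\# kG$-modules $M,N$, $\operatorname{Hom}_A(M,N)$ is a left $G$-module by $(g\rightharpoonup f)(m)=g\cdot f(g^{-1}\cdot m)$, and this induces a left $G$-module structure on each $\operatorname{Ext}^i_A(M,N)$ (compute Ext using a projective resolution of $M$ by $A\# kG$-modules, which are also projective over $A$). In particular $G$ acts on $\int^l_A$, since $k$ and $A$ are left $A\# kG$-modules. For a right $A$-module $Y$, $Y\# kG$ denotes $Y\otimes kG$ with right $A\# kG$-action $(y\otimes g)\cdot(a\# h)=y\cdot(ga)\otimes gh$. The diagonal left $G$-action on $\int^l_A\# kG$ is $g\cdot(\alpha\# h)=(g\cdot\alpha)\# gh$. For a left $G$-module $X$, $X^G=\{x\in X: gx=x \text{ for all } g\in G\}$. *)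

(* Defs.v *)
From HB Require Import structures.
From mathcomp Require Import all_boot all_order all_fingroup all_algebra.
From mathcomp Require Import generic_quotient ring_quotient.
From mathcomp Require Import boolp classical_sets functions.
From mathcomp Require multinomials.freeg.
Set Implicit Arguments.
Unset Strict Implicit.
Unset Printing Implicit Defensive.
Import GRing.Theory.
Local Open Scope ring_scope.
Local Open Scope quotient_scope.

(* Left modules over R are [lmodType R]; right modules over R are left modules
   over the converse ring R^c, so [rdot t a] is written t.a on paper. *)
Notation rmodType R := (lmodType (R^c : nzRingType)).
Definition rdot (R : nzRingType) (Y : rmodType R) (t : Y) (a : R) : Y :=
  (a : R^c) *: t.

Section Quotient.
Variables (R : nzRingType) (V : lmodType R) (B : submodClosed V).

Definition submod_pred : {pred V} := B.
Fact submod_predB : zmod_closed submod_pred.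
Proof.
split=> [|x y xB yB]; first exact: rpred0.
by rewrite /submod_pred -scaleN1r rpredD // rpredZ.
Qed.
HB.instance Definition _ := GRing.isZmodClosed.Build V submod_pred submod_predB.

Definition quotmod := Quotient.quot submod_pred.
HB.instance Definition _ := EqQuotient.on quotmod.
HB.instance Definition _ := GRing.Zmodule.on quotmod.

Definition quot_pi (x : V) : quotmod := \pi_quotmod x.
Definition quot_scale (a : R) (x : quotmod) : quotmod := quot_pi (a *: repr x).

Lemma quot_piP x y : quot_pi x = quot_pi y <-> x - y \in B.
Proof.
rewrite -[x - y \in B]/(x - y \in submod_pred) Quotient.idealrBE.
by split=> /eqP.
Qed.

Lemma quot_repr x : quot_pi (repr x) = x.
Proof. exact: reprK. Qed.

Lemma quot_piD x y : quot_pi (x + y) = quot_pi x + quot_pi y.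
Proof. exact: (raddfD \pi_(Quotient.quot submod_pred)). Qed.

Lemma quot_scale_pi a x : quot_scale a (quot_pi x) = quot_pi (a *: x).
Proof.
apply/quot_piP; rewrite -scalerBr rpredZ //.
by apply/quot_piP; rewrite quot_repr.
Qed.

Fact quot_scaleA a b x :
  quot_scale a (quot_scale b x) = quot_scale (a * b) x.
Proof. by rewrite -[x]quot_repr !quot_scale_pi scalerA. Qed.

Fact quot_scale1 : left_id 1 quot_scale.
Proof. by move=> x; rewrite -[x]quot_repr quot_scale_pi scale1r. Qed.

Fact quot_scaleDr : right_distributive quot_scale +%R.
Proof.
move=> a x y; rewrite -[x]quot_repr -[y]quot_repr -quot_piD !quot_scale_pi.
by rewrite scalerDr quot_piD.
Qed.

Fact quot_scaleDl x : {morph quot_scale^~ x : a b / a + b}.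
Proof.
move=> a b; rewrite -[x]quot_repr !quot_scale_pi.
by rewrite scalerDl quot_piD.
Qed.

HB.instance Definition _ := GRing.Zmodule_isLmodule.Build R quotmod
  quot_scaleA quot_scale1 quot_scaleDr quot_scaleDl.

Fact quot_pi_is_linear : linear quot_pi.
Proof. by move=> a x y; rewrite quot_piD -quot_scale_pi. Qed.
HB.instance Definition _ := GRing.isLinear.Build R V quotmod _ quot_pi
  quot_pi_is_linear.
End Quotient.

Definition rmod_iso_onto (R : nzRingType) (E Y : rmodType R) (X : set Y) :
    Prop :=
  exists phi : {linear E -> Y}, injective phi /\ range phi = X.

Section Homological.
Variable R : nzRingType.

Definition projective (P : lmodType R) : Prop :=
  forall (M N : lmodType R) (p : {linear M -> N}) (f : {linear P -> N}),
    (forall y, exists x, p x = y) ->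
    exists g : {linear P -> M}, forall x, p (g x) = f x.

Definition injective_mod (I : lmodType R) : Prop :=
  forall (M N : lmodType R) (j : {linear M -> N}) (f : {linear M -> I}),
    injective j ->
    exists g : {linear N -> I}, forall x, g (j x) = f x.

Record chain_complex := ChainComplex {
  chain :> nat -> lmodType R;
  chain_d : forall i, {linear chain i.+1 -> chain i};
  chain_dd : forall i x, chain_d i (chain_d i.+1 x) = 0
}.

Definition proj_resolution (M : lmodType R) (P : chain_complex) : Prop :=
  (forall i, projective (P i)) /\
  exists e : {linear P 0 -> M},
    [/\ forall y, exists x, e x = y,
        forall x, e x = 0 <-> exists y, x = chain_d P 0 y
      & forall i x, chain_d P i x = 0 <-> exists y, x = chain_d P i.+1 y].

(* [injdim_le M n]: M has an injective resolution
   0 -> M -> I 0 -> I 1 -> ... with I i = 0 for i > n. *)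
Definition injdim_le (M : lmodType R) (n : nat) : Prop :=
  exists (I : nat -> lmodType R) (d : forall i, {linear I i -> I i.+1})
         (e : {linear M -> I 0}),
    [/\ forall i, injective_mod (I i),
        forall i (x : I i), (n < i)%N -> x = 0,
        injective e,
        forall x, d 0 x = 0 <-> exists y, x = e y
      & forall i x, d i.+1 x = 0 <-> exists y, x = d i y].

Definition injdim_eq (M : lmodType R) (d : nat) : Prop :=
  injdim_le M d /\ forall n, injdim_le M n -> (d <= n)%N.

Definition left_ideal (I : set R) : Prop :=
  [/\ I 0, forall x y, I x -> I y -> I (x + y) & forall a x, I x -> I (a * x)].

Definition left_noetherian : Prop :=
  forall I : nat -> set R, (forall n, left_ideal (I n)) ->
    (forall n, I n `<=` I n.+1)%classic ->
    exists N, forall n, (N <= n)%N -> I n = I N.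

(* For P a projective resolution of M, [Ext P i] is Ext^i_R(M, R), i.e. the
   cohomology of Hom_R(P, R) in degree i.  Pointwise right multiplication,
   (f.a)(x) = f(x) a, makes the functions P_i -> R a right R-module, in which
   the cocycles and the coboundaries are submodules; (R^c)^o is R as a right
   module over itself. *)
Section Ext.
Variables (P : chain_complex) (i : nat).

Definition cochain_fun := P i -> (R^c)^o.
HB.instance Definition _ := GRing.Lmodule.on cochain_fun.

Definition is_hom (M : lmodType R) (f : M -> R) : Prop :=
  linear (f : M -> R^o).

Lemma is_homP (M : lmodType R) (f : M -> R) :
  is_hom f <-> forall a x y, f (a *: x + y) = a * f x + f y.
Proof. by []. Qed.

Lemma is_hom_comb (M : lmodType R) (a : R) (f g : M -> R) :
  is_hom f -> is_hom g -> is_hom (fun x => f x * a + g x).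
Proof.
move=> /is_homP fl /is_homP gl; apply/is_homP => b x y.
by rewrite fl gl mulrDl mulrDr mulrA addrACA.
Qed.

Definition cocycle : {pred cochain_fun} := fun f =>
  `[< is_hom (f : P i -> R) /\ forall x, f (chain_d P i x) = 0 >].

Fact cocycle_submod : submod_closed cocycle.
Proof.
split.
  apply/asboolP; split=> //; apply/is_homP => a x y.
  by rewrite mulr0 addr0.
move=> a f g /asboolP[fl fd] /asboolP[gl gd]; apply/asboolP; split.
  exact: (is_hom_comb a fl gl).
move=> x; have /= E := congr2 +%R (congr1 (fun b : R => b * a) (fd x)) (gd x).
by rewrite mul0r addr0 in E.
Qed.
HB.instance Definition _ :=
  GRing.isSubmodClosed.Build _ cochain_fun cocycle cocycle_submod.

Definition cocycles := {f : cochain_fun | f \in cocycle}.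
HB.instance Definition _ := SubChoice.on cocycles.
HB.instance Definition _ := [SubChoice_isSubLmodule of cocycles by <:].
End Ext.

Definition is_coboundary (P : chain_complex) (i : nat) :
    (P i -> R) -> Prop :=
  match i with
  | 0 => fun f => forall x, f x = 0
  | j.+1 => fun f => exists2 h : P j -> R, is_hom h &
              forall x, f x = h (chain_d P j x)
  end.

Lemma is_coboundary0 (P : chain_complex) i : @is_coboundary P i (fun=> 0).
Proof.
case: i => [|i] //; exists (fun=> 0) => //; apply/is_homP => a x y.
by rewrite mulr0 addr0.
Qed.

Lemma is_coboundary_comb (P : chain_complex) i (a : R) (f g : P i -> R) :
  @is_coboundary P i f -> @is_coboundary P i g ->
  @is_coboundary P i (fun x => f x * a + g x).
Proof.
case: i f g => [|i] f g /= fB gB; first by move=> x; rewrite fB gB mul0r addr0.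
case: fB gB => [h hl fh] [h' h'l gh]; exists (fun x => h x * a + h' x).
  exact: is_hom_comb.
by move=> x; rewrite fh gh.
Qed.

Section Ext2.
Variables (P : chain_complex) (i : nat).
Definition coboundary : {pred cocycles P i} := fun f =>
  `[< @is_coboundary P i (val f) >].

Fact coboundary_submod : submod_closed coboundary.
Proof.
split; first by apply/asboolP; exact: is_coboundary0.
move=> a f g /asboolP fB /asboolP gB; apply/asboolP.
exact: (is_coboundary_comb a fB gB).
Qed.
HB.instance Definition _ :=
  GRing.isSubmodClosed.Build _ (cocycles P i) coboundary coboundary_submod.

Definition Ext : rmodType R := quotmod coboundary.
Definition Ext_class (f : cocycles P i) : Ext := quot_pi coboundary f.
End Ext2.
End Homological.

Definition resmod (A S : nzRingType) (phi : {rmorphism A -> S})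
  (M : lmodType S) : Type := M.

Section Restriction.
Variables (A S : nzRingType) (phi : {rmorphism A -> S}).

Section Module.
Variable M : lmodType S.
Local Notation resmod := (resmod phi M).
HB.instance Definition _ := GRing.Zmodule.on resmod.
Definition res_scale (a : A) (x : resmod) : resmod := phi a *: (x : M).
Fact res_scaleA a b x : res_scale a (res_scale b x) = res_scale (a * b) x.
Proof. by rewrite /res_scale scalerA rmorphM. Qed.
Fact res_scale1 : left_id 1 res_scale.
Proof. by move=> x; rewrite /res_scale rmorph1 scale1r. Qed.
Fact res_scaleDr : right_distributive res_scale +%R.
Proof. by move=> a x y; rewrite /res_scale scalerDr. Qed.
Fact res_scaleDl x : {morph res_scale^~ x : a b / a + b}.
Proof. by move=> a b; rewrite /res_scale rmorphD scalerDl. Qed.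
HB.instance Definition _ := GRing.Zmodule_isLmodule.Build A resmod
  res_scaleA res_scale1 res_scaleDr res_scaleDl.
End Module.

Section Map.
Variables (M N : lmodType S) (f : {linear M -> N}).
Definition resmap (x : resmod phi M) : resmod phi N := f x.
Fact resmap_is_linear : linear resmap.
Proof. by move=> a x y; rewrite /resmap -linearP. Qed.
HB.instance Definition _ := GRing.isLinear.Build A
  (resmod phi M) (resmod phi N) _ resmap resmap_is_linear.
End Map.

Variable P : chain_complex S.
Fact res_complex_dd i (x : resmod phi (P i.+2)) :
  resmap (chain_d P i) (resmap (chain_d P i.+1) x) = 0.
Proof. exact: chain_dd. Qed.
Definition res_complex : chain_complex A :=
  ChainComplex res_complex_dd.
End Restriction.

(* Every module has a projective (free) resolution, so the quantification over
   all of them in [left_AS_Gorenstein] is never vacuous. *)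
Section Existence.
Import multinomials.freeg.
Variable R : nzRingType.

Definition free_mod (M : lmodType R) : lmodType R := {freeg M / R}.

HB.instance Definition _ (K : choiceType) (M : lmodType R) (f : K -> M) :=
  GRing.isZmodMorphism.Build {freeg K / R} M (fglift f) (lift_is_additive f).
Lemma fglift_linear (K : choiceType) (M : lmodType R) (f : K -> M) :
  linear (fglift f : {freeg K / R} -> M).
Proof.
have U (D : {freeg K / R}) : D = \sum_(z <- dom D) << coeff z D *g z >>.
  by rewrite freeg_sumE.
move=> a x y; rewrite raddfD; congr (_ + _).
rewrite [x]U; elim: (dom x) => [|z s IH].
  by rewrite big_nil !(scaler0, raddf0).
rewrite big_cons scalerDr !raddfD IH; congr (_ + _).
have -> : a *: << (coeff z x) *g z >> = << (a * coeff z x) *g z >>.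
  by apply/eqP/freeg_eqP => u; rewrite coeffZ !coeffU mulrA.
by rewrite /= !liftU scalerA.
Qed.
HB.instance Definition _ (K : choiceType) (M : lmodType R) (f : K -> M) :=
  GRing.isLinear.Build R {freeg K / R} M _ (fglift f) (fglift_linear f).

Lemma free_mod_projective M : projective (free_mod M).
Proof.
move=> N L p f psurj.
have [s sP] := choice (fun x : M => psurj (f << x >>)).
exists (fglift s : {linear free_mod M -> N}) => x /=.
rewrite -[x]freeg_sumE !raddf_sum; apply: eq_bigr => z _ /=.
rewrite liftU linearZ /= sP -linearZ /=; congr (f _).
by apply/eqP/freeg_eqP => u; rewrite coeffZ !coeffU mul1r.
Qed.

Section Kernel.
Variables (M N : lmodType R) (f : {linear M -> N}).
Definition ker_pred : {pred M} := fun x => f x == 0.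
Fact ker_submod : submod_closed ker_pred.
Proof.
split=> [|a x y]; rewrite /in_mem /= /ker_pred ?linear0 // => /eqP fx /eqP fy.
by rewrite linearP fx fy scaler0 addr0.
Qed.
HB.instance Definition _ := GRing.isSubmodClosed.Build _ M ker_pred ker_submod.
Definition kernel := {x : M | x \in ker_pred}.
HB.instance Definition _ := SubChoice.on kernel.
HB.instance Definition _ := [SubChoice_isSubLmodule of kernel by <:].
End Kernel.

Definition ev (M : lmodType R) : {linear free_mod M -> M} := fglift id.
Definition syzygy (M : lmodType R) (n : nat) : lmodType R :=
  iter n (fun N : lmodType R => kernel (ev N) : lmodType R) M.

Lemma ev_surj M y : exists x, ev M x = y.
Proof. by exists << y >>; rewrite /= liftU scale1r. Qed.

Definition std_d M n :
    {linear free_mod (syzygy M n.+1) -> free_mod (syzygy M n)} :=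
  (val : kernel (ev (syzygy M n)) -> _) \o ev (syzygy M n.+1).
Fact std_dd M n x : std_d M n (std_d M n.+1 x) = 0.
Proof.
rewrite /=; case: (fglift _ x) => /= y /eqP E.
by rewrite [fglift _ y]E.
Qed.
Definition std_resolution M : chain_complex R := ChainComplex (@std_dd M).

Lemma std_exact M n x : ev (syzygy M n) x = 0 <-> exists y, x = std_d M n y.
Proof.
split=> [/eqP x0|[y ->]]; last first.
  by rewrite /=; case: (fglift _ y) => /= z /eqP.
have [y yE] := ev_surj (Sub x x0 : kernel (ev (syzygy M n))).
by exists y; rewrite /= [fglift _ y]yE.
Qed.

Lemma std_resolutionP M : proj_resolution M (std_resolution M).
Proof.
split=> [i|]; first exact: free_mod_projective.
exists (ev M); split; first exact: ev_surj.
  exact: (@std_exact M 0).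
move=> i x; rewrite -[_ <-> _]/(_ <-> exists y, x = std_d M i.+1 y) -std_exact.
split=> [xd|xe].
  by apply: val_inj; exact: xd.
by rewrite /= [fglift _ x]xe.
Qed.

Theorem proj_resolution_exists (M : lmodType R) :
  exists P, proj_resolution M P.
Proof. by exists (std_resolution M); exact: std_resolutionP. Qed.
End Existence.

Section Augmented.
Variables (k : fieldType) (A : algType k).

Definition augmentation := {lrmorphism A -> k | *%R}.

Definition augmod (eps : augmentation) : lmodType A := resmod eps k^o.

(* A right A-module is a k-space through k -> A. *)
Definition kscale (Y : rmodType A) (c : k) (t : Y) : Y := rdot t c%:A.

Definition one_dim (Y : rmodType A) : Prop :=
  exists2 v : Y, v != 0 & forall t, exists c : k, t = kscale c v.

(* Ext^i_A(k, A) may be computed from any projective resolution of k. *)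
Definition left_AS_Gorenstein (eps : augmentation) (d : nat) : Prop :=
  [/\ left_noetherian A,
      injdim_eq A^o d
    & forall P, proj_resolution (augmod eps) P ->
        one_dim (Ext P d) /\
        forall i, i != d -> forall t : Ext P i, t = 0].

Variable G : finGroupType.

Definition is_gmodule (Y : rmodType A) (r : G -> Y -> Y) : Prop :=
  [/\ forall t, r 1%g t = t,
      forall g h t, r (g * h)%g t = r g (r h t)
    & forall g c t u, r g (kscale c t + u) = kscale c (r g t) + r g u].

Record gmod_alg := GModAlg {
  gmod_act :> G -> {lrmorphism A -> A};
  gmod_act1 : forall a, gmod_act 1%g a = a;
  gmod_actM : forall g h a, gmod_act (g * h)%g a = gmod_act g (gmod_act h a)
}.

Record aug_gmod_alg := AugGModAlg {
  aug_act :> gmod_alg;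
  aug : augmentation;
  aug_gact : forall g a, aug (aug_act g a) = aug a
}.
End Augmented.

(* x : {ffun G -> A} stands for the sum of the x g # g. *)
Definition skew_alg (k : fieldType) (A : algType k) (G : finGroupType)
  (act : gmod_alg A G) := {ffun G -> A}.

Section Skew.
Variables (k : fieldType) (A : algType k) (G : finGroupType).
Variable act : gmod_alg A G.
Local Notation skew_alg := (skew_alg act).

HB.instance Definition _ := GRing.Lmodule.on skew_alg.

Definition skew_elt (a : A) (g : G) : skew_alg :=
  [ffun h => if h == g then a else 0].
Definition skew_one : skew_alg := skew_elt 1 1%g.
Definition skew_mul (x y : skew_alg) : skew_alg :=
  [ffun h => \sum_g x g * act g (y (g^-1 * h)%g)].

Fact skew_mulA : associative skew_mul.
Proof.
move=> x y z; apply/ffunP => h; rewrite !ffunE.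
under eq_bigr => g _.
  rewrite ffunE linear_sum /= mulr_sumr.
  rewrite (reindex_inj (mulgI g^-1%g)) /=.
  under eq_bigr => l _ do
    rewrite rmorphM /= -gmod_actM mulKVg invMg invgK -mulgA mulKVg mulrA.
  over.
rewrite exchange_big /=; apply: eq_bigr => l _.
by rewrite ffunE mulr_suml.
Qed.

Fact skew_mul1 : left_id skew_one skew_mul.
Proof.
move=> x; apply/ffunP => h; rewrite !ffunE (bigD1 1%g) //= big1 ?addr0.
  by rewrite ffunE eqxx mul1r gmod_act1 invg1 mul1g.
by move=> g /negPf ng; rewrite ffunE ng mul0r.
Qed.

Fact skew_mulr1 : right_id skew_one skew_mul.
Proof.
move=> x; apply/ffunP => h; rewrite !ffunE (bigD1 h) //= big1 ?addr0.
  by rewrite ffunE mulVg eqxx rmorph1 mulr1.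
move=> g ng; rewrite ffunE -eq_mulVg1 (negPf ng) raddf0 mulr0 //.
Qed.

Fact skew_mulDl : left_distributive skew_mul +%R.
Proof.
move=> x y z; apply/ffunP => h; rewrite !ffunE -big_split /=.
by apply: eq_bigr => g _; rewrite ffunE mulrDl.
Qed.

Fact skew_mulDr : right_distributive skew_mul +%R.
Proof.
move=> x y z; apply/ffunP => h; rewrite !ffunE -big_split /=.
by apply: eq_bigr => g _; rewrite ffunE raddfD mulrDr.
Qed.

Fact skew_neq0 : skew_one != 0.
Proof.
apply/eqP => /ffunP/(_ 1%g); rewrite !ffunE eqxx => /eqP.
by rewrite oner_eq0.
Qed.

HB.instance Definition _ := GRing.Zmodule_isNzRing.Build skew_alg
  skew_mulA skew_mul1 skew_mulr1 skew_mulDl skew_mulDr skew_neq0.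

Fact skew_scaleAl (c : k) (x y : skew_alg) : c *: (x * y) = c *: x * y.
Proof.
apply/ffunP => h; rewrite !ffunE scaler_sumr.
by apply: eq_bigr => g _; rewrite ffunE scalerAl.
Qed.
HB.instance Definition _ := GRing.Lmodule_isLalgebra.Build k skew_alg
  skew_scaleAl.

Fact skew_scaleAr (c : k) (x y : skew_alg) : c *: (x * y) = x * (c *: y).
Proof.
apply/ffunP => h; rewrite !ffunE scaler_sumr.
by apply: eq_bigr => g _; rewrite ffunE linearZ /= scalerAr.
Qed.
HB.instance Definition _ := GRing.Lalgebra_isAlgebra.Build k skew_alg
  skew_scaleAr.

Lemma skew_eltM a g b h :
  skew_elt a g * skew_elt b h = skew_elt (a * act g b) (g * h)%g.
Proof.
apply/ffunP => l; rewrite !ffunE (bigD1 g) //= big1 ?addr0.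
  rewrite !ffunE eqxx (can2_eq (mulKVg g) (mulKg g)).
  by case: eqP => // _; rewrite raddf0 mulr0.
by move=> i /negPf ni; rewrite ffunE ni mul0r.
Qed.

Lemma skew_sum (x : skew_alg) : x = \sum_g skew_elt (x g) g.
Proof.
apply/ffunP => l; rewrite sum_ffunE (bigD1 l) //= big1 ?addr0.
  by rewrite ffunE eqxx.
by move=> i /negPf ni; rewrite ffunE eq_sym ni.
Qed.

Definition skew_in (a : A) : skew_alg := skew_elt a 1%g.
Fact skew_inB : zmod_morphism skew_in.
Proof.
by move=> a b; apply/ffunP => h; rewrite !ffunE; case: eqP; rewrite // subr0.
Qed.
Fact skew_inM : monoid_morphism skew_in.
Proof. by split=> // a b; rewrite /skew_in skew_eltM gmod_act1 mulg1. Qed.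
HB.instance Definition _ := GRing.isZmodMorphism.Build A skew_alg skew_in
  skew_inB.
HB.instance Definition _ :=
  GRing.isMonoidMorphism.Build A skew_alg skew_in skew_inM.
End Skew.

Section SkewAugmentation.
Variables (k : fieldType) (A : algType k) (G : finGroupType).
Variable S : aug_gmod_alg A G.

Definition skew_eps (x : skew_alg S) : k := \sum_g aug S (x g).

Fact skew_epsB : zmod_morphism skew_eps.
Proof.
move=> x y; rewrite /skew_eps -sumrB; apply: eq_bigr => g _.
by rewrite !ffunE raddfB.
Qed.
Fact skew_epsM : monoid_morphism skew_eps.
Proof.
split=> [|x y]; rewrite /skew_eps.
  rewrite (bigD1 1%g) //= big1 ?addr0 ?ffunE ?eqxx ?rmorph1 //.
  by move=> g /negPf ng; rewrite ffunE ng raddf0.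
under eq_bigr do rewrite ffunE raddf_sum.
rewrite exchange_big mulr_suml; apply: eq_bigr => g _ /=.
rewrite mulr_sumr (reindex_inj (mulgI g)) /=; apply: eq_bigr => h _.
by rewrite mulKg rmorphM /= aug_gact.
Qed.
Fact skew_epsZ : scalable_for *%R skew_eps.
Proof.
move=> c x; rewrite /skew_eps mulr_sumr; apply: eq_bigr => g _.
by rewrite ffunE linearZ.
Qed.
HB.instance Definition _ := GRing.isZmodMorphism.Build (skew_alg S) k skew_eps
  skew_epsB.
HB.instance Definition _ := GRing.isMonoidMorphism.Build (skew_alg S) k skew_eps
  skew_epsM.
HB.instance Definition _ := GRing.isScalable.Build k (skew_alg S) k *%R skew_eps
  skew_epsZ.

Definition skew_aug : augmentation (skew_alg S) := skew_eps.
Lemma skew_augE a g : skew_aug (skew_elt S a g) = aug S a.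
Proof.
rewrite /= /skew_eps (bigD1 g) //= big1 ?addr0 ?ffunE ?eqxx //.
by move=> h /negPf nh; rewrite ffunE nh raddf0.
Qed.
End SkewAugmentation.

(* F : {ffun G -> Y} stands for the sum of the F g (x) g. *)
Definition skewmod (k : fieldType) (A : algType k) (G : finGroupType)
  (act : gmod_alg A G) (Y : rmodType A) := {ffun G -> Y}.

Section SkewModule.
Variables (k : fieldType) (A : algType k) (G : finGroupType).
Variables (act : gmod_alg A G) (Y : rmodType A).
Local Notation skewmod := (skewmod act Y).
HB.instance Definition _ := GRing.Zmodule.on skewmod.

Definition skewmod_act (F : skewmod) (x : skew_alg act) : skewmod :=
  [ffun h => \sum_g rdot (F g) (act g (x (g^-1 * h)%g))].
Definition skewmod_scale (x : (skew_alg act)^c) (F : skewmod) : skewmod :=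
  skewmod_act F x.

Lemma ractM (t : Y) a b : rdot (rdot t a) b = rdot t (a * b).
Proof. exact: scalerA. Qed.

Fact skewmod_scaleA x y F :
  skewmod_scale x (skewmod_scale y F) = skewmod_scale (x * y) F.
Proof.
apply/ffunP => h; rewrite !ffunE.
under eq_bigr => m _.
  rewrite ffunE /rdot scaler_sumr.
  under eq_bigr do rewrite -/(rdot _ _) -/(rdot _ _) ractM.
  over.
rewrite exchange_big /=; apply: eq_bigr => g _.
rewrite ffunE raddf_sum /rdot scaler_suml.
rewrite [RHS](reindex_inj (mulgI g^-1%g)) /=; apply: eq_bigr => m _.
by rewrite rmorphM /= -gmod_actM mulKVg invMg invgK -mulgA mulKVg.
Qed.
Fact skewmod_scale1 : left_id 1 skewmod_scale.
Proof.
move=> F; apply/ffunP => h; rewrite ffunE (bigD1 h) //= big1 ?addr0.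
  by rewrite ffunE mulVg eqxx rmorph1 /rdot scale1r.
by move=> g ng; rewrite ffunE -eq_mulVg1 (negPf ng) raddf0 /rdot scale0r.
Qed.
Fact skewmod_scaleDr : right_distributive skewmod_scale +%R.
Proof.
move=> x F F'; apply/ffunP => h; rewrite !ffunE -big_split /=.
by apply: eq_bigr => g _; rewrite ffunE /rdot scalerDr.
Qed.
Fact skewmod_scaleDl F : {morph skewmod_scale^~ F : x y / x + y}.
Proof.
move=> x y; apply/ffunP => h; rewrite !ffunE -big_split /=.
by apply: eq_bigr => g _; rewrite ffunE raddfD /rdot scalerDl.
Qed.
HB.instance Definition _ :=
  GRing.Zmodule_isLmodule.Build (skew_alg act)^c skewmod
  skewmod_scaleA skewmod_scale1 skewmod_scaleDr skewmod_scaleDl.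

Definition skewmod_elt (y : Y) (g : G) : skewmod :=
  [ffun h => if h == g then y else 0].

Lemma skewmod_eltE y g a h :
  skewmod_act (skewmod_elt y g) (skew_elt act a h) =
  skewmod_elt (rdot y (act g a)) (g * h)%g.
Proof.
apply/ffunP => l; rewrite !ffunE (bigD1 g) //= big1 ?addr0.
  rewrite !ffunE eqxx (can2_eq (mulKVg g) (mulKg g)).
  by case: eqP => // _; rewrite raddf0 /rdot scale0r.
by move=> i /negPf ni; rewrite ffunE ni /rdot scaler0.
Qed.
End SkewModule.

Section ExtAction.
Variables (k : fieldType) (A : algType k) (G : finGroupType).
Variable act : gmod_alg A G.

(* (g -> f)(m) = g . f(g^-1 . m), where g acts on an A # kG-module through
   1 # g, hence on A through [act]. *)
Definition hom_act (M : lmodType (skew_alg act)) (g : G) (f : M -> A)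
    (m : M) : A :=
  act g (f (skew_elt act 1 g^-1%g *: m)).

Lemma hom_act_hom (M : lmodType (skew_alg act)) g (f : M -> A) :
  is_hom (f : resmod (skew_in act) M -> A) ->
  is_hom (hom_act g f : resmod (skew_in act) M -> A).
Proof.
move=> /is_homP fl; apply/is_homP => a x y; rewrite /hom_act.
have -> : skew_elt act 1 g^-1%g *: ((a *: x + y) : resmod (skew_in act) M) =
   (act g^-1%g a *: (skew_elt act 1 g^-1%g *: (x : M) : resmod (skew_in act) M)
    + (skew_elt act 1 g^-1%g *: (y : M))) :> resmod (skew_in act) M.
  rewrite -[RHS]/(skew_in act (act g^-1%g a) *:
      (skew_elt act 1 g^-1%g *: (x : M))
    + (skew_elt act 1 g^-1%g *: (y : M)) : M).
  rewrite scalerA /skew_in skew_eltM rmorph1 mulr1 mul1g.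
  rewrite -[LHS]/(skew_elt act 1 g^-1%g *:
     (skew_elt act a 1%g *: (x : M) + (y : M)) : M).
  by rewrite scalerDr scalerA skew_eltM mul1r mulg1.
by rewrite fl raddfD /= rmorphM /= -gmod_actM mulgV gmod_act1.
Qed.

Variables (P : chain_complex (skew_alg act)) (i : nat).
Local Notation PA := (res_complex (skew_in act) P).

Lemma is_coboundary_act g (f : P i -> A) :
  @is_coboundary A PA i f -> @is_coboundary A PA i (hom_act g f).
Proof.
case: i f => [|j] f /=; first by move=> f0 x; rewrite /hom_act [f _]f0 raddf0.
case=> h hl fh; exists (hom_act g (h : P j -> A)); first exact: hom_act_hom.
move=> x; rewrite /hom_act [f _]fh -[chain_d PA j x]/(chain_d P j x).
by rewrite -linearZ.
Qed.

Fact cocycle_act_subproof g (f : cocycles PA i) :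
  (hom_act g (val f : P i -> A) : cochain_fun PA i) \in @cocycle A PA i.
Proof.
case: f => f /= /asboolP[fl fd]; apply/asboolP; split.
  exact: hom_act_hom.
move=> x; rewrite /hom_act.
rewrite -[chain_d PA i x]/(chain_d P i x) -linearZ.
by rewrite [f _](fd (skew_elt act 1 g^-1%g *: x : P i.+1)) raddf0.
Qed.
Definition cocycle_act g (f : cocycles PA i) : cocycles PA i :=
  Sub (hom_act g (val f : P i -> A)) (cocycle_act_subproof g f).

Definition Ext_act (g : G) (t : Ext PA i) : Ext PA i :=
  Ext_class (cocycle_act g (repr t)).

Lemma Ext_act_class g (f : cocycles PA i) :
  Ext_act g (Ext_class f) = Ext_class (cocycle_act g f).
Proof.
apply/quot_piP; set r := repr _.
have /asboolP : r - f \in @coboundary A PA i.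
  by apply/quot_piP; exact: quot_repr.
have -> : cocycle_act g r - cocycle_act g f = cocycle_act g (r - f).
  apply/val_inj/funext => x; apply/esym.
  exact: (raddfB (act g) (val r (skew_elt act 1 g^-1%g *: (x : P i)))
                         (val f (skew_elt act 1 g^-1%g *: (x : P i)))).
move: (r - f) => {r}{}f fB; apply/asboolP; case: f fB => f /= _.
exact: is_coboundary_act.
Qed.

Definition skew_diag_act (g : G) (F : skewmod act (Ext PA i)) :
    skewmod act (Ext PA i) :=
  [ffun h => Ext_act g (F (g^-1 * h)%g)].

Definition skew_invariants : set (skewmod act (Ext PA i)) :=
  [set F | forall g, skew_diag_act g F = F]%classic.
End ExtAction.

(* Main.v *)
Require Import Defs.
From HB Require Import structures.
From mathcomp Require Import all_boot all_order all_fingroup all_algebra.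
From mathcomp Require Import generic_quotient.
From mathcomp Require Import boolp classical_sets functions.
Set Implicit Arguments.
Unset Strict Implicit.
Unset Printing Implicit Defensive.
Import GRing.Theory.
Local Open Scope ring_scope.

(** Write B = A # kG.  Everything follows from one adjunction.  For a left
    A-module N, the induced module B (x)_A N is the space of functions
    F : G -> N, and since G is finite it is also coinduced: B-linear maps
    M -> Ind N correspond to A-linear maps M -> N, by evaluation at the
    identity of G (lemma [coext]).  As Ind is exact, its left adjoint,
    restriction to A, preserves projectives ([res_projective]); as restriction
    is exact, Ind preserves injectives ([ind_injective]).

    The first fact shows that a projective B-resolution P of k restricts to a
    projective A-resolution of k, so that the AS-Gorenstein hypothesis on A
    computes the cohomology of Hom_A(P, A); the assertions on the action of G
    are then read off from cocycles.  The second fact, applied to an injective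
    resolution of A and to B = Ind A, bounds the injective dimension of B by d
    ([injdim_skew]).

    For the Ext groups of B, the adjunction with N = A identifies Hom_B(P, B)
    with Hom_A(P, A): a B-linear f : P_i -> B is determined by its coefficient
    at the identity, because its coefficient at h is the transform of that one
    by h.  Recording all coefficients, f |-> (h |-> coefficient of f at h), is
    right B-linear from Ext_B(k, B) to Ext_A(k, A) # kG; it is injective, and
    its image consists of the F with F h = h . F 1, which are the invariants of
    the diagonal action ([Ext_skew_embedding]).  Evaluation at the identity
    then matches Ext_B(k, B) with Ext_A(k, A), hence dimension one in degree d
    and zero elsewhere.  Nonvanishing in degree d forces the injective
    dimension of B to be at least d, by the usual dimension shifting
    ([Ext_eq0]).

    B is left Noetherian because it is free of finite rank as a left A-module
    ([skew_noetherian]).  When the integral of B is computed from another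
    resolution Q, the comparison theorem ([Ext_iso]) gives an isomorphism of
    right modules between the two versions of Ext. *)

(** * Lifting and extending linear maps *)

Lemma linear_bundle (R : nzRingType) (U V : lmodType R) (f : U -> V) :
  linear f -> exists g : {linear U -> V}, g =1 f.
Proof.
move=> lf; pose g : {linear U -> V} :=
  HB.pack f (GRing.isLinear.Build R U V _ f lf).
by exists g.
Qed.

Lemma quot_lift (R : nzRingType) (V W : lmodType R) (B : submodClosed V)
    (f : {linear V -> W}) :
  (forall x, x \in B -> f x = 0) ->
  exists g : {linear quotmod B -> W}, forall x, g (quot_pi B x) = f x.
Proof.
move=> f0; have fE x : f (repr (quot_pi B x)) = f x.
  apply/eqP; rewrite -subr_eq0 -linearB; apply/eqP/f0.
  by apply/quot_piP; rewrite quot_repr.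
have [a x y|g gE] := @linear_bundle R (quotmod B) W (fun x => f (repr x)).
  rewrite -[x]quot_repr -[y]quot_repr -linearP !fE; exact: linearP.
by exists g => x; rewrite gE fE.
Qed.

(** The map [q] need only reach the image of [f]: the projection to P of the
    pullback of [q] and [f] is then onto, and splits since P is projective. *)
Lemma projective_lift (R : nzRingType) (P M N : lmodType R)
    (q : {linear M -> N}) (f : {linear P -> N}) :
  projective P -> (forall x, exists y, q y = f x) ->
  exists g : {linear P -> M}, forall x, q (g x) = f x.
Proof.
move=> projP fq.
have [a [x y] [x' y']|u uE] :=
    @linear_bundle R (M * P)%type N (fun z => q z.1 - f z.2).
  by rewrite /= [q _]linearP [f _]linearP scalerBr opprD addrACA.
have [a x y|p2 p2E] := @linear_bundle R (kernel u) P (fun z => (val z).2).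
  by rewrite linearP.
have [a x y|p1 p1E] := @linear_bundle R (kernel u) M (fun z => (val z).1).
  by rewrite linearP.
have [|s sE] := projP _ _ p2 idfun.
  move=> x; have [y qy] := fq x.
  have k : (y, x) \in ker_pred u by apply/eqP; rewrite uE /= qy subrr.
  by exists (Sub (y, x) k); rewrite p2E.
exists (p1 \o s : {linear _ -> _}) => x; rewrite /= p1E.
move: (sE x); rewrite p2E /= => {2}<-.
by apply/eqP; rewrite -subr_eq0 -uE; exact: (valP (s x)).
Qed.

(** Dual statement for a non-injective [d]: [f] factors through X / ker d, which
    embeds in Y. *)
Lemma injective_extend (R : nzRingType) (I X Y : lmodType R)
    (d : {linear X -> Y}) (f : {linear X -> I}) :
  injective_mod I -> (forall x, d x = 0 -> f x = 0) ->
  exists g : {linear Y -> I}, forall x, g (d x) = f x.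
Proof.
move=> injI f0.
have [x /eqP|j jE] := @quot_lift R X Y (ker_pred d) d; first by [].
have [x /eqP/f0|f' f'E] := @quot_lift R X I (ker_pred d) f; first by [].
have [x y|g gE] := injI _ _ j f'.
  rewrite -[x]quot_repr -[y]quot_repr !jE => dE; apply/quot_piP.
  by apply/eqP; rewrite linearB dE subrr.
by exists g => x; rewrite -jE gE f'E.
Qed.

(** * Vanishing of Ext above the injective dimension *)

(** Dimension shifting, by induction on [i].  Extending [f] to [g] on P_i moves
    the cocycle [f] to the cocycle dI o g, of degree one less in P and one more
    in I; a primitive [h] of the latter lifts to I_j, and correcting [g] by that
    lift makes it land in the cycles.  The bound on [i + j] ends the descent:
    in degree 0, dI o g takes its values in I_(j+1), which is zero. *)
Lemma injective_resolution_shift (R : nzRingType) (P : chain_complex R)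
    (I : nat -> lmodType R) (dI : forall i, {linear I i -> I i.+1}) n i j
    (f : {linear P i.+1 -> I j}) :
  (forall i, projective (P i)) ->
  (forall i x, chain_d P i x = 0 -> exists y, x = chain_d P i.+1 y) ->
  (forall i, injective_mod (I i)) ->
  (forall i (x : I i), (n < i)%N -> x = 0) ->
  (forall i x, dI i.+1 x = 0 <-> exists y, x = dI i y) ->
  (n <= i + j)%N ->
  (forall x, f (chain_d P i.+1 x) = 0) -> (forall x, dI j (f x) = 0) ->
  exists h : {linear P i -> I j},
    (forall x, dI j (h x) = 0) /\ (forall x, f x = h (chain_d P i x)).
Proof.
move=> projP exP injI I0 exI; elim: i j f => [|i IH] j f nij fd df.
  have [x /exP[y ->]|g gE] :=
      injective_extend (d := chain_d P 0) (f := f) (injI j); first exact: fd.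
  by exists g; split=> x //; apply: I0.
have [x /exP[y ->]|g gE] :=
    injective_extend (d := chain_d P i.+1) (f := f) (injI j); first exact: fd.
have [|x|x|h [hd hE]] := IH j.+1 (dI j \o g : {linear _ -> _}).
- by rewrite addnS -addSn.
- by rewrite /= gE df.
- by rewrite /=; apply/exI; exists (g x).
have [x|h' h'E] := @projective_lift R (P i) (I j) (I j.+1) (dI j) h (projP i).
  by have /exI[y ->] := hd x; exists y.
have [a x y|u uE] := @linear_bundle R (P i.+1) (I j)
    (fun x => g x - h' (chain_d P i x)).
  rewrite [g _]linearP [chain_d _ _ _]linearP [h' _]linearP.
  by rewrite scalerBr opprD addrACA.
exists u; split=> x; rewrite uE.
  by rewrite linearB h'E -hE /= subrr.
by rewrite chain_dd linear0 subr0 gE.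
Qed.

Lemma Ext_eq0 (R : nzRingType) (P : chain_complex R) n i :
  (forall i, projective (P i)) ->
  (forall i x, chain_d P i x = 0 -> exists y, x = chain_d P i.+1 y) ->
  injdim_le R^o n -> (n < i)%N -> forall t : Ext P i, t = 0.
Proof.
move=> projP exP [I [dI [e [injI I0 e_inj exI0 exI]]]].
case: i => // i lt_ni t; rewrite -[t]quot_repr.
case: (repr t) => f fc; rewrite -[RHS](linear0 (quot_pi _)).
apply/quot_piP; rewrite subr0; apply/asboolP => /=.
have /asboolP[f_lin fd] := fc.
have [f' f'E] := linear_bundle f_lin.
have [|x|x|h [hd hE]] := @injective_resolution_shift R P I dI n i 0
   (e \o f' : {linear _ -> _}) projP exP injI I0 exI.
- by rewrite addn0.
- by rewrite /= f'E fd linear0.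
- by rewrite /=; apply/exI0; exists (f' x).
have [g gE] := @choice _ _ (fun x y => h x = e y) (fun x => (exI0 _).1 (hd x)).
exists g.
  by move=> a x y; apply: e_inj; rewrite linearP -!gE linearP.
by move=> x; apply: e_inj; rewrite -gE -hE /= f'E.
Qed.

(** * The comparison theorem *)

Definition resolves (R : nzRingType) (M : lmodType R) (P : chain_complex R)
    (e : {linear P 0 -> M}) : Prop :=
  [/\ forall y, exists x, e x = y,
      forall x, e x = 0 <-> exists y, x = chain_d P 0 y
    & forall i x, chain_d P i x = 0 <-> exists y, x = chain_d P i.+1 y].

Definition chain_map (R : nzRingType) (P Q : chain_complex R)
    (phi : forall i, {linear P i -> Q i}) : Prop :=
  forall i x, chain_d Q i (phi i.+1 x) = phi i (chain_d P i x).

Lemma dependent_choice_nat (T : nat -> Type) (good : forall i, T i -> Prop)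
    (E : forall i, T i -> T i.+1 -> Prop) (x0 : T 0%N) :
  good 0%N x0 ->
  (forall i x, good i x -> exists y, good i.+1 y /\ E i x y) ->
  exists u : forall i, T i, u 0%N = x0 /\ forall i, E i (u i) (u i.+1).
Proof.
move=> x0P step.
pose st i := {x : T i | good i x}.
have step' i (x : st i) : {y : st i.+1 | E i (sval x) (sval y)}.
  by have /cid[y [gy Ey]] := step i _ (svalP x); exists (exist _ y gy).
pose u := fix u i : st i :=
  if i is j.+1 then sval (step' j (u j)) else exist _ x0 x0P.
exists (fun i => sval (u i)); split=> // i; exact: (svalP (step' i (u i))).
Qed.

(** The inductive invariant is that the map in degree [i] sends boundaries to
    boundaries; exactness of Q transmits it to the next degree. *)
Lemma chain_map_exists (R : nzRingType) (M : lmodType R)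
    (P Q : chain_complex R) (e : {linear P 0%N -> M})
    (e' : {linear Q 0%N -> M}) :
  (forall i, projective (P i)) -> (forall x, e (chain_d P 0 x) = 0) ->
  resolves e' ->
  exists phi : forall i, {linear P i -> Q i},
    (forall x, e' (phi 0%N x) = e x) /\ chain_map phi.
Proof.
move=> projP ed [e'_surj ex0 ex].
have [x|phi0 phi0E] := projective_lift (projP 0%N) (q := e') (f := e).
  exact: e'_surj.
pose good i (f : {linear P i -> Q i}) :=
  forall x, exists y, f (chain_d P i x) = chain_d Q i y.
pose E i (f : {linear P i -> Q i}) (g : {linear P i.+1 -> Q i.+1}) :=
  forall x, chain_d Q i (g x) = f (chain_d P i x).
have [x|i f fgood|phi [phi0' phiE]] := dependent_choice_nat (good := good)
    (E := E) (x0 := phi0).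
- by apply/ex0; rewrite phi0E ed.
- have [x|g gE] := projective_lift (projP i.+1) (q := chain_d Q i)
      (f := f \o chain_d P i : {linear _ -> _}).
    by have [y yE] := fgood x; exists y.
  exists g; split=> // x; apply/ex.
  by rewrite gE /= chain_dd linear0.
by exists phi; rewrite phi0'; split.
Qed.

(** Only the component [s] of the homotopy in one degree is recorded.  The
    component in the next degree is replaced by the existence of [y], which is
    all that matters once a cocycle, killing boundaries, is applied; a single
    induction then suffices, with no coherent choice of all components. *)
Lemma chain_map_homotopy (R : nzRingType) (M : lmodType R)
    (P Q : chain_complex R) (e' : {linear Q 0%N -> M})
    (phi psi : forall i, {linear P i -> Q i}) i :
  (forall i, projective (P i)) -> resolves e' ->
  chain_map phi -> chain_map psi ->
  (forall x, e' (phi 0%N x) = e' (psi 0%N x)) ->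
  exists s : {linear P i -> Q i.+1},
    forall x, exists y,
      phi i.+1 x - psi i.+1 x = s (chain_d P i x) + chain_d Q i.+1 y.
Proof.
move=> projP [_ ex0 ex] phiC psiC e0.
have step j (u : {linear P j -> Q j}) :
    (forall x, exists y, u x = chain_d Q j y) ->
    (forall x, u (chain_d P j x) =
               phi j (chain_d P j x) - psi j (chain_d P j x)) ->
    exists s : {linear P j -> Q j.+1}, (forall x, u x = chain_d Q j (s x)) /\
     forall x, exists y,
      phi j.+1 x - psi j.+1 x = s (chain_d P j x) + chain_d Q j.+1 y.
  move=> ub uE; have [x|s sE] := projective_lift (projP j) (q := chain_d Q j)
      (f := u).
    by have [y yE] := ub x; exists y.
  exists s; split=> [x|x]; first by rewrite sE.
  have /ex[y yE] : chain_d Q j (phi j.+1 x - psi j.+1 x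
                               - s (chain_d P j x)) = 0.
    by rewrite !linearB /= sE uE phiC psiC subrr.
  by exists y; rewrite -yE [RHS]addrC subrK.
elim: i => [|i [s sE]].
  have [a x y|u uE] := @linear_bundle R (P 0%N) (Q 0%N)
      (fun x => phi 0%N x - psi 0%N x).
    by rewrite [phi _ _]linearP [psi _ _]linearP scalerBr opprD addrACA.
  have [x|x|s [_ sE]] := step 0%N u.
  - by apply/ex0; rewrite uE linearB e0 subrr.
  - by rewrite uE.
  by exists s.
have [a x y|u uE] := @linear_bundle R (P i.+1) (Q i.+1)
    (fun x => phi i.+1 x - psi i.+1 x - s (chain_d P i x)).
  rewrite [phi _ _]linearP [psi _ _]linearP [chain_d _ _ _]linearP.
  rewrite [s _]linearP.
  by rewrite !scalerBr !opprD [RHS]addrACA; congr (_ + _); rewrite addrACA.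
have [x|x|t [_ tE]] := step i.+1 u.
- have [y yE] := sE x; exists y.
  by rewrite uE yE addrC addKr.
- by rewrite uE chain_dd linear0 subr0.
by exists t.
Qed.

Section ExtMap.
Variables (R : nzRingType) (P Q : chain_complex R).
Variables (phi : forall i, {linear P i -> Q i}) (phiC : chain_map phi).

Fact cocycle_pull i (f : cocycles Q i) :
  ((fun x => val f (phi i x)) : cochain_fun P i) \in @cocycle R P i.
Proof.
case: f => f /= /asboolP[/is_homP f_lin fd]; apply/asboolP; split.
  by apply/is_homP => a x y; rewrite linearP f_lin.
by move=> x; rewrite -phiC fd.
Qed.

Definition cocycle_map i (f : cocycles Q i) : cocycles P i :=
  Sub ((fun x => val f (phi i x)) : cochain_fun P i) (cocycle_pull f).

Lemma Ext_map i : exists F : {linear Ext Q i -> Ext P i},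
  forall f, F (Ext_class f) = Ext_class (cocycle_map f).
Proof.
have [//|u uE] := @linear_bundle R^c (cocycles Q i) (Ext P i)
    (fun f => Ext_class (cocycle_map f)).
  move=> a f g; rewrite -linearP; congr (quot_pi _ _).
  by apply/val_inj.
have [f /asboolP fB|F FE] := @quot_lift R^c _ _ (@coboundary R Q i) u.
  rewrite uE -[RHS](linear0 (quot_pi _)); apply/quot_piP; rewrite subr0.
  apply/asboolP => /=; case: i f fB {u uE} => [|i] f /=.
    by move=> f0 x; rewrite f0.
  case=> h /is_homP h_lin fE; exists (fun x => h (phi i x)).
    by apply/is_homP => a x y; rewrite linearP h_lin.
  by move=> x; rewrite fE phiC.
by exists F => f; rewrite FE uE.
Qed.
End ExtMap.

Lemma Ext_homotopic (R : nzRingType) (M : lmodType R) (Q : chain_complex R)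
    (e : {linear Q 0%N -> M}) (phi : forall i, {linear Q i -> Q i})
    (phiC : chain_map phi) i (f : cocycles Q i) :
  (forall i, projective (Q i)) -> resolves e ->
  (forall x, e (phi 0%N x) = e x) ->
  Ext_class (cocycle_map phiC f) = Ext_class f.
Proof.
move=> projQ resQ ephi; apply/quot_piP; apply/asboolP.
have /asboolP[/is_homP f_lin fd] := valP f.
have fB x y : val f (x - y) = val f x - val f y.
  by rewrite addrC -scaleN1r f_lin mulN1r addrC.
case: i f f_lin fd fB => [|i] f f_lin fd fB /=.
  move=> x; have [_ ex0 _] := resQ.
  have /ex0[y yE] : e (phi 0%N x - x) = 0 by rewrite linearB ephi subrr.
  by apply: etrans (esym (fB _ _)) _; rewrite yE fd.
have idC : chain_map (fun j => idfun : {linear Q j -> Q j}) by [].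
have [s sE] := chain_map_homotopy i projQ resQ phiC idC ephi.
exists (fun x => val f (s x)).
  by apply/is_homP => a x y; rewrite linearP f_lin.
move=> x; apply: etrans (esym (fB _ _)) _; have [y ->] := sE x.
by rewrite addrC -[chain_d _ _ _]scale1r f_lin fd mulr0 add0r.
Qed.

Lemma Ext_iso (R : nzRingType) (M : lmodType R) (P Q : chain_complex R) i :
  proj_resolution M P -> proj_resolution M Q ->
  exists F : {linear Ext Q i -> Ext P i},
    injective F /\ forall t, exists u, F u = t.
Proof.
move=> [projP [e resP]] [projQ [e' resQ]].
have ed x : e (chain_d P 0 x) = 0 by case: resP => _ E _; apply/E; exists x.
have ed' x : e' (chain_d Q 0 x) = 0 by case: resQ => _ E _; apply/E; exists x.
have [phi [phi0 phiC]] := chain_map_exists projP ed resQ.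
have [psi [psi0 psiC]] := chain_map_exists projQ ed' resP.
have [F FE] := Ext_map phiC i; have [F' FE'] := Ext_map psiC i.
have cPP : chain_map (fun j => psi j \o phi j : {linear P j -> P j}).
  by move=> j x /=; rewrite psiC phiC.
have cQQ : chain_map (fun j => phi j \o psi j : {linear Q j -> Q j}).
  by move=> j x /=; rewrite phiC psiC.
exists F; split.
  apply: (can_inj (g := F')) => t; rewrite -[t]quot_repr FE FE'.
  rewrite -[RHS](Ext_homotopic cQQ (repr t) projQ resQ).
    by congr (quot_pi _ _); apply: val_inj.
  by move=> x /=; rewrite phi0 psi0.
move=> t; exists (F' t); rewrite -[t]quot_repr FE' FE.
rewrite -[RHS](Ext_homotopic cPP (repr t) projP resP).
  by congr (quot_pi _ _); apply: val_inj.
by move=> x /=; rewrite psi0 phi0.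
Qed.

(** * The skew group algebra over A *)

(** The tensor product (A # kG) (x)_A N, where F stands for the sum of the
    (1 # h) (x) F h.  Moving a coefficient a past 1 # h twists it by the inverse
    of h, whence the formula for [ind_scale] below. *)
Definition indmod (k : fieldType) (A : algType k) (G : finGroupType)
  (act : gmod_alg A G) (N : lmodType A) := {ffun G -> N}.

Section SkewAlgebra.
Variables (k : fieldType) (A : algType k) (G : finGroupType).
Variable act : gmod_alg A G.
Local Notation B := (skew_alg act).
Local Notation ind := (indmod act).

Lemma skew_elt_mulE a g (x : B) h :
  (skew_elt act a g * x) h = a * act g (x (g^-1 * h)%g).
Proof.
rewrite ffunE (bigD1 g) //= big1 ?addr0 ?ffunE ?eqxx //.
by move=> l /negPf nl; rewrite ffunE nl mul0r.
Qed.

Lemma skew_in_mulE a (x : B) h : (skew_in act a * x) h = a * x h.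
Proof. by rewrite skew_elt_mulE gmod_act1 invg1 mul1g. Qed.

(** Leading coefficients: order G and let L g n be the left ideal of the
    coefficients at [g] of the elements of I n whose earlier coefficients
    vanish.  Each chain L g stabilises, and once they all have, so has I. *)
Lemma skew_noetherian : left_noetherian A -> left_noetherian B.
Proof.
move=> noethA I idI incI.
have incIn n m : (n <= m)%N -> forall x, I n x -> I m x.
  elim: m => [|m IH]; first by rewrite leqn0 => /eqP->.
  by rewrite leq_eqVlt ltnS => /predU1P[->//|/IH inc] x /inc/incI.
pose vanish j (x : B) := forall g, (enum_rank g < j)%N -> x g = 0.
pose L g n : set A := [set a |
  exists x, [/\ I n x, vanish (enum_rank g) x & x g = a]]%classic.
have idL g n : left_ideal (L g n).
  have [I0 ID IM] := idI n; split.
  - by exists 0; split=> // [h _|]; rewrite ffunE.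
  - move=> _ _ [x [Ix vx <-]] [y [Iy vy <-]]; exists (x + y); split.
    + exact: ID.
    + by move=> h lt_h; rewrite ffunE vx ?vy ?addr0.
    + by rewrite ffunE.
  - move=> a _ [x [Ix vx <-]]; exists (skew_in act a * x); split.
    + exact: IM.
    + by move=> h lt_h; rewrite skew_in_mulE vx ?mulr0.
    + by rewrite skew_in_mulE.
have incL g n : (L g n `<=` L g n.+1)%classic.
  by move=> _ [x [Ix vx <-]]; exists x; split=> //; exact: incI.
have [N NP] := choice (fun g => noethA (L g) (idL g) (incL g)).
pose N0 := (\max_g N g)%N.
exists N0 => n leNn; apply/seteqP; split; last exact: incIn.
have [I0 ID _] := idI N0.
have InB x y : I n x -> I n y -> I n (x - y).
  have [_ InD InM] := idI n.
  by move=> Ix Iy; rewrite -mulN1r; apply: InD => //; exact: InM.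
(* Subtract elements of I N0 to clear the coefficients of x one by one. *)
suff red m j x : (#|G| - j <= m)%N -> I n x -> vanish j x -> I N0 x.
  by move=> x Ix; apply: (red _ 0%N x (leqnn _) Ix) => g; rewrite ltn0.
elim: m j x => [|m IH] j x lejm Ix vx; have [lejG|ltjG] := leqP #|G| j.
- suff -> : x = 0 by [].
  by apply/ffunP=> g; rewrite ffunE vx ?(leq_trans (ltn_ord _)).
- by move: lejm; rewrite leqn0 subn_eq0 leqNgt ltjG.
- suff -> : x = 0 by [].
  by apply/ffunP=> g; rewrite ffunE vx ?(leq_trans (ltn_ord _)).
pose g := enum_val (Ordinal ltjG).
have gE : enum_rank g = j :> nat by rewrite enum_valK.
have leNg : (N g <= N0)%N by exact: leq_bigmax.
have : L g N0 (x g).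
  rewrite (NP g _ leNg) -(NP g n (leq_trans leNg leNn)).
  by exists x; split=> //; rewrite gE.
case=> y [Iy vy yE]; rewrite -[x](subrK y); apply: (ID) => //.
apply: (IH j.+1).
- by rewrite subnS -ltnS (ltn_predK (m := 0)) // subn_gt0.
- exact: InB Ix (incIn _ _ leNn _ Iy).
move=> h; rewrite ltnS leq_eqVlt => /predU1P[hj|lthj].
  have -> : h = g by apply/enum_rank_inj/val_inj; rewrite /= hj gE.
  by rewrite !ffunE yE subrr.
by rewrite !ffunE vx // vy ?gE // subrr.
Qed.

Section Ind.
Variable N : lmodType A.
HB.instance Definition _ := GRing.Zmodule.on (ind N).

Definition ind_scale (x : B) (F : ind N) : ind N :=
  [ffun h => \sum_g act h^-1%g (x g) *: F (g^-1 * h)%g].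

Fact ind_scaleA x y F : ind_scale x (ind_scale y F) = ind_scale (x * y) F.
Proof.
apply/ffunP => h; rewrite !ffunE.
under [RHS]eq_bigr => m _ do rewrite ffunE raddf_sum scaler_suml.
rewrite [RHS]exchange_big /=; apply: eq_bigr => g _.
rewrite ffunE scaler_sumr [RHS](reindex_inj (mulgI g)) /=.
apply: eq_bigr => l _; rewrite mulKg rmorphM /= -gmod_actM scalerA.
by rewrite !invMg invgK mulgA.
Qed.
Fact ind_scale1 : left_id 1 ind_scale.
Proof.
move=> F; apply/ffunP => h; rewrite ffunE (bigD1 1%g) //= big1 ?addr0.
  by rewrite ffunE eqxx rmorph1 scale1r invg1 mul1g.
by move=> g /negPf ng; rewrite ffunE ng raddf0 scale0r.
Qed.
Fact ind_scaleDr : right_distributive ind_scale +%R.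
Proof.
move=> x F F'; apply/ffunP => h; rewrite !ffunE -big_split /=.
by apply: eq_bigr => g _; rewrite ffunE scalerDr.
Qed.
Fact ind_scaleDl F : {morph ind_scale^~ F : x y / x + y}.
Proof.
move=> x y; apply/ffunP => h; rewrite !ffunE -big_split /=.
by apply: eq_bigr => g _; rewrite ffunE raddfD scalerDl.
Qed.
HB.instance Definition _ := GRing.Zmodule_isLmodule.Build B (ind N)
  ind_scaleA ind_scale1 ind_scaleDr ind_scaleDl.

Lemma ind_scale_elt a g (F : ind N) h :
  (skew_elt act a g *: F) h = act h^-1%g a *: F (g^-1 * h)%g.
Proof.
rewrite ffunE (bigD1 g) //= big1 ?addr0 ?ffunE ?eqxx //.
by move=> l /negPf nl; rewrite ffunE nl raddf0 scale0r.
Qed.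

Lemma ind_ev1 : exists f : {linear resmod (skew_in act) (ind N) -> N},
  forall F, f F = F 1%g.
Proof.
apply: linear_bundle => a F F'; rewrite ffunE; congr (_ + _).
by rewrite [LHS]ind_scale_elt invg1 gmod_act1 mul1g.
Qed.

(** Ind is right adjoint to restriction: evaluating F at the identity gives back
    [f], and B-linearity forces the other values. *)
Lemma coext (M : lmodType B) (f : {linear resmod (skew_in act) M -> N}) :
  exists F : {linear M -> ind N},
    forall m h, F m h = f (skew_elt act 1 h^-1%g *: m).
Proof.
pose F0 (m : M) : ind N := [ffun h => f (skew_elt act 1 h^-1%g *: m)].
have [x m m'|F FE] := @linear_bundle B M (ind N) F0; last first.
  by exists F => m h; rewrite FE ffunE.
apply/ffunP => h; rewrite !ffunE scalerDr [f _]raddfD; congr (_ + _).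
have -> : skew_elt act 1 h^-1%g *: (x *: m) = \sum_g
    (skew_in act (act h^-1%g (x g)) *: (skew_elt act 1 (h^-1 * g)%g *: m)).
  rewrite scalerA {1}[x]skew_sum mulr_sumr scaler_suml; apply: eq_bigr => g _.
  by rewrite scalerA !skew_eltM gmod_act1 mulr1 !mul1g mul1r.
rewrite [LHS](raddf_sum f); apply: eq_bigr => g _.
by rewrite ffunE invMg invgK -[RHS]linearZ.
Qed.
End Ind.

Let res_map (M N : lmodType B) (f : {linear M -> N}) :
  {linear resmod (skew_in act) M -> resmod (skew_in act) N} := resmap f.

Lemma ind_map (M N : lmodType A) (p : {linear M -> N}) :
  exists q : {linear ind M -> ind N}, forall F h, q F h = p (F h).
Proof.
have [x F F'|q qE] := @linear_bundle B (ind M) (ind N)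
   (fun F => [ffun h => p (F h)]); last by exists q => F h; rewrite qE ffunE.
apply/ffunP => h; rewrite !ffunE [p _]raddfD; congr (_ + _).
by rewrite raddf_sum; apply: eq_bigr => g _; rewrite ffunE /= linearZ.
Qed.

Lemma ind_injective (I : lmodType A) :
  injective_mod I -> injective_mod (ind I : lmodType B).
Proof.
move=> injI M N j f j_inj; have [ev evE] := ind_ev1 I.
have [//|g gE] := injI _ _ (res_map j)
  (ev \o res_map f : {linear _ -> _}).
have [H HE] := coext g; exists H => m; apply/ffunP => h.
rewrite HE -linearZ [LHS]gE /= evE /resmap [f _]linearZ /=.
by rewrite ind_scale_elt rmorph1 scale1r invgK mulg1.
Qed.

Lemma res_projective (P : lmodType B) :
  projective P -> projective (resmod (skew_in act) P : lmodType A).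
Proof.
move=> projP M N p f p_surj; have [q qE] := ind_map p.
have [s sE] := choice p_surj.
have [H HE] := coext f; have [ev evE] := ind_ev1 M.
have [F|g gE] := projP _ _ q H.
  by exists [ffun h => s (F h)]; apply/ffunP => h; rewrite qE ffunE sE.
exists (ev \o res_map g : {linear _ -> _}) => x.
rewrite /= evE -qE gE HE invg1; congr (f _); exact: scale1r.
Qed.

(** Inducing an injective resolution of A gives one of Ind A, and B is isomorphic
    to Ind A by sending x to h |-> h^-1 . x h; composed with the coaugmentation
    [e] this is the map [eB]. *)
Lemma injdim_skew n : injdim_le A^o n -> injdim_le B^o n.
Proof.
move=> [I [dI [e [injI I0 e_inj exI0 exI]]]].
have [dB dBE] : exists dB : forall i,
    {linear (ind (I i) : lmodType B) -> (ind (I i.+1) : lmodType B)},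
    forall i F h, dB i F h = dI i (F h).
  have dB i := cid (ind_map (dI i)).
  by exists (fun i => sval (dB i)) => i; exact: (svalP (dB i)).
have [a x y|f fE] := @linear_bundle A (resmod (skew_in act) B^o) (I 0%N)
    (fun x => e ((x : B) 1%g)).
  rewrite -linearP; congr (e _); rewrite ffunE; congr (_ + _).
  exact: skew_in_mulE.
have [eB eBE] := coext f.
have {}eBE x h : eB x h = e (act h^-1%g (x h)).
  by rewrite eBE fE [X in e X]skew_elt_mulE mul1r invgK mulg1.
exists (fun i => ind (I i) : lmodType B), dB, eB; split.
- by move=> i; exact: ind_injective.
- by move=> i F lt_ni; apply/ffunP => h; rewrite ffunE; apply: I0.
- move=> x y xy; apply/ffunP => h; have : eB x h = eB y h by rewrite xy.
  rewrite !eBE => /e_inj /(congr1 (act h)).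
  by rewrite -!gmod_actM mulgV !gmod_act1.
- move=> F; split=> [F0|[x ->]]; last first.
    apply/ffunP => h; rewrite dBE ffunE; apply/exI0; rewrite eBE.
    by exists (act h^-1%g (x h)).
  have FE h : exists a, F h = e a by apply/exI0; rewrite -dBE F0 ffunE.
  have [s sE] := choice FE; exists [ffun h => act h (s h)].
  by apply/ffunP => h; rewrite eBE ffunE -gmod_actM mulVg gmod_act1.
- move=> i F; split=> [F0|[x ->]]; last first.
    apply/ffunP => h; rewrite dBE ffunE; apply/exI; rewrite dBE.
    by exists (x h).
  have FE h : exists y, F h = dI i y by apply/exI; rewrite -dBE F0 ffunE.
  have [s sE] := choice FE; exists [ffun h => s h].
  by apply/ffunP => h; rewrite dBE ffunE.
Qed.
End SkewAlgebra.

(** * Ext of the skew group algebra *)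

Lemma is_homZ (R : nzRingType) (M : lmodType R) (f : M -> R) a x :
  is_hom f -> f (a *: x) = a * f x.
Proof. by move=> /linear_bundle[f' f'E]; rewrite -!f'E linearZ. Qed.

Lemma Ext_class_surj (R : nzRingType) (P : chain_complex R) i (t : Ext P i) :
  exists f, t = Ext_class f.
Proof. by exists (repr t); rewrite /Ext_class quot_repr. Qed.

Lemma Ext_class_eq (R : nzRingType) (P : chain_complex R) i
    (f g : cocycles P i) :
  Ext_class f = Ext_class g <-> is_coboundary (val f - val g : P i -> R).
Proof. by split=> [/quot_piP/asboolP|fg]; last by apply/quot_piP/asboolP. Qed.

Lemma Ext_classP (R : nzRingType) (P : chain_complex R) i (a : R)
    (f g : cocycles P i) :
  rdot (Ext_class f) a + Ext_class g = Ext_class ((a : R^c) *: f + g).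
Proof. exact/esym/(linearP (quot_pi _)). Qed.

Section ExtSkew.
Variables (k : fieldType) (A : algType k) (G : finGroupType).
Variable act : gmod_alg A G.
Local Notation B := (skew_alg act).
Variables (P : chain_complex B) (i : nat).
Local Notation PA := (res_complex (skew_in act) P).

Lemma cocycle_act1 (f : cocycles PA i) : cocycle_act 1%g f = f.
Proof.
apply/val_inj/funext => m /=; rewrite /hom_act gmod_act1 invg1.
congr (sval f _); exact: scale1r.
Qed.

Lemma cocycle_actM g h (f : cocycles PA i) :
  cocycle_act (g * h)%g f = cocycle_act g (cocycle_act h f).
Proof.
apply/val_inj/funext => m /=; rewrite /hom_act gmod_actM scalerA.
by rewrite skew_eltM rmorph1 mulr1 invMg.
Qed.

Lemma cocycle_act_comb g a (f f' : cocycles PA i) :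
  cocycle_act g ((a : A^c) *: f + f') =
  (act g a : A^c) *: cocycle_act g f + cocycle_act g f'.
Proof.
apply/val_inj/funext => m /=.
exact: etrans (rmorphD (act g) _ _) (congr2 +%R (rmorphM (act g) _ _) erefl).
Qed.

Lemma Ext_act_comb g a (t u : Ext PA i) :
  Ext_act g (rdot t a + u) = rdot (Ext_act g t) (act g a) + Ext_act g u.
Proof.
have [f ->] := Ext_class_surj t; have [f' ->] := Ext_class_surj u.
by rewrite Ext_classP !Ext_act_class cocycle_act_comb -Ext_classP.
Qed.

Lemma Ext_act_rdot g a (t : Ext PA i) :
  Ext_act g (rdot t a) = rdot (Ext_act g t) (act g a).
Proof.
have act0 : Ext_act g (0 : Ext PA i) = 0.
  have := Ext_act_comb g 1 (0 : Ext PA i) 0.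
  rewrite /rdot rmorph1 !scale1r addr0 => /eqP.
  by rewrite -subr_eq0 opprD addNKr oppr_eq0 => /eqP.
by rewrite -[rdot t a]addr0 Ext_act_comb act0 addr0.
Qed.

Lemma Ext_act_is_gmodule : is_gmodule (@Ext_act k A G act P i).
Proof.
split=> [t|g h t|g c t u].
- by have [f ->] := Ext_class_surj t; rewrite Ext_act_class cocycle_act1.
- have [f ->] := Ext_class_surj t.
  by rewrite !Ext_act_class cocycle_actM.
- by rewrite /kscale Ext_act_comb linearZ /= rmorph1.
Qed.

Lemma is_hom_component (M : lmodType B) (f : M -> B) (h : G) :
  is_hom f -> is_hom ((fun m => f m h) : resmod (skew_in act) M -> A).
Proof.
move=> /is_homP f_lin; apply/is_homP => a x y.
rewrite -[a *: x]/(skew_in act a *: (x : M)) f_lin ffunE.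
by congr (_ + _); exact: skew_in_mulE.
Qed.

(** The adjunct of [f] in Ind A, read in A # kG. *)
Lemma is_hom_assemble (M : lmodType B) (f : resmod (skew_in act) M -> A) :
  is_hom f -> is_hom ((fun m => [ffun h => hom_act h (f : M -> A) m]) : M -> B).
Proof.
move=> /linear_bundle[f' f'E]; have [F FE] := coext f'.
apply/is_homP => x m m'; apply/ffunP => h; rewrite !ffunE /hom_act.
rewrite -!f'E -!FE linearP !ffunE rmorphD raddf_sum; congr (_ + _).
apply: eq_bigr => g _; rewrite ffunE -f'E -FE.
apply: etrans (rmorphM (act h) _ _) _; rewrite /=.
by rewrite -!gmod_actM mulgV gmod_act1 mulKVg.
Qed.

Fact cocycle_component_subproof h (f : cocycles P i) :
  ((fun m => (val f m : B) h) : cochain_fun PA i) \in @cocycle A PA i.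
Proof.
case: f => f /= /asboolP[fl fd]; apply/asboolP; split.
  exact: is_hom_component.
by move=> x; rewrite [f _]fd ffunE.
Qed.
Definition cocycle_component h (f : cocycles P i) : cocycles PA i :=
  Sub ((fun m => (val f m : B) h) : cochain_fun PA i)
    (cocycle_component_subproof h f).

Fact cocycle_assemble_subproof (f : cocycles PA i) :
  ((fun m => [ffun h => hom_act h (val f : P i -> A) m]) : cochain_fun P i)
    \in @cocycle B P i.
Proof.
case: f => f /= /asboolP[fl fd]; apply/asboolP; split.
  exact: is_hom_assemble.
move=> x; apply/ffunP => h; rewrite !ffunE /hom_act -linearZ [f _]fd.
by rewrite raddf0.
Qed.
Definition cocycle_assemble (f : cocycles PA i) : cocycles P i :=
  Sub ((fun m => [ffun h => hom_act h (val f : P i -> A) m]) : cochain_fun P i)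
    (cocycle_assemble_subproof f).

Lemma component_assemble h f :
  cocycle_component h (cocycle_assemble f) = cocycle_act h f.
Proof. by apply/val_inj/funext => m /=; rewrite ffunE. Qed.

(** Multiplication by 1 # g permutes the coefficients of an element of B while
    applying g to them, so B-linearity ties all coefficients of [f] together. *)
Lemma act_component g h f :
  cocycle_act g (cocycle_component h f) = cocycle_component (g * h)%g f.
Proof.
apply/val_inj/funext => m /=; rewrite /hom_act.
have /asboolP[f_lin _] := valP f.
rewrite [sval f _](is_homZ _ _ f_lin) skew_elt_mulE mul1r.
by rewrite -gmod_actM mulgV gmod_act1 invgK.
Qed.

Lemma component_comb h (x : B) (f f' : cocycles P i) :
  cocycle_component h ((x : B^c) *: f + f') =
  \sum_g (act g (x (g^-1 * h)%g) : A^c) *: cocycle_component g f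
  + cocycle_component h f'.
Proof.
apply/val_inj/funext => m; rewrite raddfD raddf_sum /=.
rewrite [LHS]ffunE; congr (_ + _); rewrite fct_sumE.
by rewrite [LHS]ffunE.
Qed.

Lemma is_coboundary_component h (f : P i -> B) :
  is_coboundary f -> @is_coboundary A PA i (fun m => f m h).
Proof.
case: i f => [|j] f /=; first by move=> f0 m; rewrite f0 ffunE.
case=> u u_lin fE; exists (fun m => u m h); first exact: is_hom_component.
by move=> m; rewrite fE.
Qed.

(** Injectivity of [Ext_skew_map] on cochains: assembling the translates of a
    primitive of the coefficient at the identity gives a primitive of [f]. *)
Lemma is_coboundary_assemble (f : P i -> B) :
  (forall m h, f m h = hom_act h (fun m => f m 1%g) m) ->
  @is_coboundary A PA i (fun m => f m 1%g) -> is_coboundary f.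
Proof.
case: i f => [|j] f fE /=.
  move=> f0 m; apply/ffunP => h; rewrite fE !ffunE.
  by rewrite /hom_act f0 raddf0.
case=> u u_lin f1; exists (fun m => [ffun h => hom_act h u m]).
  exact: is_hom_assemble.
by move=> m; apply/ffunP => h; rewrite fE ffunE /hom_act f1 -linearZ.
Qed.

Lemma Ext_skew_map : exists F : {linear Ext P i -> skewmod act (Ext PA i)},
  forall f h, F (Ext_class f) h = Ext_class (cocycle_component h f).
Proof.
have [x f f'|u uE] := @linear_bundle B^c (cocycles P i)
    (skewmod act (Ext PA i))
    (fun f => [ffun h => Ext_class (cocycle_component h f)]).
  apply/ffunP => h; rewrite !ffunE component_comb.
  rewrite [LHS](raddfD (quot_pi _)) raddf_sum /=; congr (_ + _).
  by apply: eq_bigr => g _; rewrite ffunE; exact: (linearZ_LR (quot_pi _)).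
have [f /asboolP fB|F FE] := @quot_lift B^c _ _ (@coboundary B P i) u.
  rewrite uE; apply/ffunP => h; rewrite !ffunE.
  rewrite -[RHS](linear0 (quot_pi _)); apply/Ext_class_eq; rewrite subr0.
  exact: is_coboundary_component.
by exists F => f h; rewrite FE uE ffunE.
Qed.

(** A G-invariant F is determined by F 1, as F h = h . F 1; hence the form of
    the injectivity clause. *)
Lemma Ext_skew_embedding :
  exists F : {linear Ext P i -> skewmod act (Ext PA i)},
    (forall t, F t 1%g = 0 -> t = 0) /\
    range F = @skew_invariants k A G act P i.
Proof.
have [F FE] := Ext_skew_map; exists F; split.
  move=> t; have [f ->] := Ext_class_surj t; rewrite FE => f0.
  rewrite -[RHS](linear0 (quot_pi _)); apply/Ext_class_eq; rewrite subr0.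
  apply: is_coboundary_assemble => [m h|].
    have := congr1 (fun u : cocycles PA i => (val u : P i -> A) m)
      (act_component h 1%g f).
    by rewrite mulg1.
  suff /Ext_class_eq : Ext_class (cocycle_component 1%g f) =
    Ext_class (0 : cocycles PA i) by rewrite subr0.
  by rewrite f0; exact/esym/(linear0 (quot_pi _)).
apply/seteqP; split.
  move=> _ [t _ <-] g; have [f ->] := Ext_class_surj t.
  apply/ffunP => h; rewrite ffunE !FE Ext_act_class act_component.
  by rewrite mulKVg.
move=> y yI; have [f fE] := Ext_class_surj (y 1%g).
exists (Ext_class (cocycle_assemble f)) => //; apply/ffunP => h.
rewrite FE component_assemble -Ext_act_class -fE.
by rewrite -[in RHS](yI h) ffunE mulVg.
Qed.

Lemma skewmod_kscale (Y : rmodType A) c (F : skewmod act Y) h :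
  (kscale c F : skewmod act Y) h = kscale c (F h).
Proof.
rewrite /kscale {1}/rdot ffunE (bigD1 h) //= big1 ?addr0 => [|g ne_gh].
  by rewrite mulVg !ffunE eqxx linearZ /= rmorph1.
by rewrite !ffunE -eq_mulVg1 (negPf ne_gh) scaler0 raddf0 /rdot scale0r.
Qed.

Lemma Ext_skew_one_dim : one_dim (Ext PA i) -> one_dim (Ext P i).
Proof.
move=> [v v0 vE]; have [act1 actM _] := Ext_act_is_gmodule.
have [F [F_inj FI]] := Ext_skew_embedding.
(* The generator w of Ext_B is the preimage of the invariant with value v at 1. *)
have [w _ wE] : range F [ffun h => Ext_act h v].
  by rewrite FI => g; apply/ffunP => h; rewrite !ffunE -actM mulKVg.
have {}wE : F w 1%g = v by rewrite wE ffunE act1.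
exists w => [|t].
  by apply: contra_neq v0 => w0; rewrite -wE w0 linear0 ffunE.
have [c cE] := vE (F t 1%g); exists c.
apply/eqP; rewrite -subr_eq0; apply/eqP/F_inj.
rewrite linearB !ffunE cE linearZ /= -wE.
by rewrite [X in _ - X]skewmod_kscale subrr.
Qed.
End ExtSkew.

(** * The homological integral *)

Lemma res_resolution (k : fieldType) (G : finGroupType) (A : algType k)
    (S : aug_gmod_alg A G) (P : chain_complex (skew_alg S)) :
  proj_resolution (augmod (skew_aug S)) P ->
  proj_resolution (augmod (aug S)) (res_complex (skew_in S) P).
Proof.
move=> [projP [e [e_surj ex0 ex]]]; split.
  by move=> i; exact: res_projective.
have [a x y|f fE] := @linear_bundle A (res_complex (skew_in S) P 0%N)
    (augmod (aug S)) (fun x => e (x : P 0%N)).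
  rewrite -[LHS]/(e (skew_in S a *: (x : P 0%N) + (y : P 0%N))) linearP.
  congr (_ + _); rewrite -[LHS]/(skew_aug S (skew_elt S a 1%g) * _).
  by rewrite skew_augE.
exists f; split=> [y|x|]; last exact: ex.
  by have [x xE] := e_surj y; exists x; rewrite fE.
by rewrite fE; exact: ex0.
Qed.

Theorem proposition1p1 (k : closedFieldType) (char0 : [pchar k] =i pred0)
    (G : finGroupType) (A : algType k) (S : aug_gmod_alg A G) (d : nat) :
  left_AS_Gorenstein (aug S) d ->
  (forall P : chain_complex (skew_alg S),
     proj_resolution (augmod (skew_aug S)) P ->
     [/\ one_dim (Ext (res_complex (skew_in S) P) d),
         is_gmodule (@Ext_act k A G S P d)
       & forall (g : G) (a : A) (t : Ext (res_complex (skew_in S) P) d),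
           Ext_act g (rdot t a) = rdot (Ext_act g t) (S g a)]) /\
  (left_AS_Gorenstein (skew_aug S) d /\
   forall P Q : chain_complex (skew_alg S),
     proj_resolution (augmod (skew_aug S)) P ->
     proj_resolution (augmod (skew_aug S)) Q ->
     rmod_iso_onto (Ext Q d) (@skew_invariants k A G S P d)).
Proof.
move=> [noethA [injA _] ExtA].
have oneA P : proj_resolution (augmod (skew_aug S)) P ->
    one_dim (Ext (res_complex (skew_in S) P) d).
  by move=> /res_resolution/ExtA[].
have zeroA P : proj_resolution (augmod (skew_aug S)) P -> forall i, i != d ->
    forall t : Ext (res_complex (skew_in S) P) i, t = 0.
  by move=> /res_resolution/ExtA[].
split=> [P resP|]; last split.
- split; [exact: oneA|exact: Ext_act_is_gmodule|exact: Ext_act_rdot].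
- split; first exact: skew_noetherian.
    split; first exact: injdim_skew.
    move=> n injB; rewrite leqNgt; apply/negP => lt_nd.
    have [P resP] := proj_resolution_exists (augmod (skew_aug S)).
    have [v /eqP[]] := Ext_skew_one_dim (oneA P resP).
    have [projP [e [_ _ ex]]] := resP.
    by apply: (Ext_eq0 projP _ injB lt_nd) => i x /ex.
  move=> P resP; split; first exact: Ext_skew_one_dim (oneA P resP).
  move=> i ne_id t; have [F [F_inj _]] := Ext_skew_embedding P i.
  exact/F_inj/(zeroA P resP).
- move=> P Q resP resQ; have [F [F_inj F_surj]] := Ext_iso d resP resQ.
  have [H [H_inj HI]] := Ext_skew_embedding P d.
  exists (H \o F : {linear _ -> _}); split.
    apply: inj_comp F_inj => t u tu; apply/eqP; rewrite -subr_eq0; apply/eqP.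
    by apply: H_inj; rewrite linearB tu subrr ffunE.
  rewrite -HI; apply/seteqP; split=> _ [t _ <-] /=; first by exists (F t).
  by have [u <-] := F_surj t; exists u.
Qed.
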